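(* Let $d, n \ge 1$ be integers, let $\alpha_1,\dots,\alpha_d \in \mathbb{R}\setminus\{0\}$ and $\beta_1,\dots,\beta_d \in \mathbb{R}$, and let $f : [-1,1]^d \times \mathbb{R}^{d+1} \to \mathbb{R}$ be the generic quadratic model $$f(x,\theta) = \theta_0 + \sum_{k=1}^d \alpha_k \theta_k x^{(k)} + \sum_{k=1}^d \beta_k \frac{\theta_k^2}{2} (x^{(k)})^2, \qquad x = (x^{(1)},\dots,x^{(d)}),\ \theta = (\theta_0,\theta_1,\dots,\theta_d).$$ Let $\tilde{x} = (x_1,\dots,x_n)$ be an experimental design with $x_i = (x_{i,1},\dots,x_{i,d}) \in \{-1,1\}^d$ for all $i$, $\sum_{i=1}^n x_i = 0$, and $\sum_{i=1}^n x_{i,k} x_{i,l} = n\,\delta_{k,l}$ for all $k,l \in \{1,\dots,d\}$. Let $\theta^* = (\theta_0^*,\dots,\theta_d^* ) \in \mathbb{R}^{d+1}$ and $\sigma > 0$ be arbitrary, and let $\tilde{y}(\tilde{x}) = (f(x_i,\theta^* ) + \varepsilon_i)_{i=1,\dots,n}$ with $\varepsilon_1,\dots,\varepsilon_n$ independent $\mathcal{N}(0,\sigma^2)$ random variables. Then for every input point $x = (x^{(1)},\dots,x^{(d)}) \in [-1,1]^d$ the expected prediction $\mu_{\tilde{x}}(x)$ and the prediction uncertainty $V_{\tilde{x}}(x)$ of the model based on $(\tilde{x},\tilde{y}(\tilde{x}))$ are $$\mu_{\tilde{x}}(x) = f(x,\theta^* ) + \frac{\sigma^2}{2n}\sum_{k=1}^d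 \frac{\beta_k}{\alpha_k^2}\big((x^{(k)})^2-1\big),$$ $$V_{\tilde{x}}(x) = \frac{\sigma^2}{n}\Big(1 + \sum_{k=1}^d \Big(x^{(k)} + \frac{\beta_k}{\alpha_k}\big((x^{(k)})^2-1\big)\theta_k^*\Big)^2\Big) + \frac{\sigma^4}{2n^2}\sum_{k=1}^d \frac{\beta_k^2}{\alpha_k^4}\big((x^{(k)})^2-1\big)^2.$$ In particular, the predictions of the estimated model $x \mapsto f(x,\hat{\theta}_f(\tilde{x},\tilde{y}(\tilde{x})))$ are biased.
   Context: For $\tilde{y} = (y_1,\dots,y_n) \in \mathbb{R}^n$, $\hat{\theta}_f(\tilde{x},\tilde{y})$ denotes the least-squares estimator, i.e. the minimizer over $\theta \in \mathbb{R}^{d+1}$ of $\sum_{i=1}^n (y_i - f(x_i,\theta))^2$ (for the designs considered here it exists and is unique). The expected prediction and prediction uncertainty are $\mu_{\tilde{x}}(x) = \mathrm{E}\big[f(x,\hat{\theta}_f(\tilde{x},\tilde{y}(\tilde{x})))\big]$ and $V_{\tilde{x}}(x) = \mathrm{Var}\big[f(x,\hat{\theta}_f(\tilde{x},\tilde{y}(\tilde{x})))\big]$. ''Biased'' means that the expected prediction $\mu_{\tilde{x}}(x)$ differs from $f(x,\hat{\theta}_f(\tilde{x},\mathrm{E}[\tilde{y}(\tilde{x})])) = f(x,\theta^* )$. $\delta_{k,l}$ is the Kronecker delta. Design points are $x_i$ with components $x_{i,k}$, and $x^{(k)}$ is the $k$th component of an input point $x$.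
   Formalization: The closing claim that the predictions are biased is proved when some β_k ≠ 0, as bias at some x in [-1,1]^d; if all β_k = 0 the mean formula shows there is no bias, and at vertices of the cube the bias always vanishes. *)

(* Defs.v *)
From HB Require Import structures.
From mathcomp Require Import all_boot all_order all_algebra.
From mathcomp Require Import all_classical all_reals all_analysis.

Set Implicit Arguments.
Unset Strict Implicit.
Unset Printing Implicit Defensive.

Import Order.TTheory GRing.Theory Num.Theory.
Import numFieldNormedType.Exports.

Local Open Scope classical_set_scope.
Local Open Scope ring_scope.

(* The coordinate [ord0] of the parameter is the intercept theta_0, and
   [lift ord0 k] is the parameter theta_k attached to the k-th input. *)
Definition quadratic_model (R : realType) (d : nat) (alpha beta : 'I_d -> R)
    (x : 'rV[R]_d) (theta : 'rV[R]_d.+1) : R :=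
  theta 0 ord0
  + \sum_(k < d) alpha k * theta 0 (lift ord0 k) * x 0 k
  + \sum_(k < d) beta k * (theta 0 (lift ord0 k) ^+ 2 / 2) * x 0 k ^+ 2.

Definition cube (R : realType) (d : nat) : set 'rV[R]_d :=
  [set x | forall k, -1 <= x 0 k <= 1].

Definition sum_squares (R : realType) (d p n : nat)
    (f : 'rV[R]_d -> 'rV[R]_p -> R) (xs : 'I_n -> 'rV[R]_d)
    (y : 'rV[R]_n) (theta : 'rV[R]_p) : R :=
  \sum_(i < n) (y 0 i - f (xs i) theta) ^+ 2.

Definition least_squares (R : realType) (d p n : nat)
    (f : 'rV[R]_d -> 'rV[R]_p -> R) (xs : 'I_n -> 'rV[R]_d)
    (y : 'rV[R]_n) : set 'rV[R]_p :=
  [set theta | forall theta',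
     sum_squares f xs y theta <= sum_squares f xs y theta'].

(* The minimizer when there is exactly one; otherwise a chosen minimizer, or 0
   when there is none. *)
Definition lse (R : realType) (d p n : nat)
    (f : 'rV[R]_d -> 'rV[R]_p -> R) (xs : 'I_n -> 'rV[R]_d)
    (y : 'rV[R]_n) : 'rV[R]_p :=
  xget 0 (least_squares f xs y).

Definition mutually_independent (R : realType) (disp : measure_display)
    (T : measurableType disp) (P : probability T R) (I : finType)
    (X : I -> T -> R) : Prop :=
  forall (J : {set I}) (B : I -> set R),
    (forall i, i \in J -> measurable (B i)) ->
    P (\bigcap_(i in [set` J]) (X i @^-1` B i))
    = (\prod_(i in J) P (X i @^-1` B i))%E.

Definition observations (R : realType) (d p n : nat) (T : Type)
    (f : 'rV[R]_d -> 'rV[R]_p -> R) (xs : 'I_n -> 'rV[R]_d)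
    (theta : 'rV[R]_p) (eps : 'I_n -> T -> R) (w : T) : 'rV[R]_n :=
  \row_(i < n) (f (xs i) theta + eps i w).

Definition mean_vector (R : realType) (disp : measure_display)
    (T : measurableType disp) (P : probability T R) (n : nat)
    (y : T -> 'rV[R]_n) : 'rV[R]_n :=
  \row_(i < n) fine ('E_P[fun w => y w 0%R i])%E.

Definition expected_prediction (R : realType) (disp : measure_display)
    (T : measurableType disp) (P : probability T R) (d p n : nat)
    (f : 'rV[R]_d -> 'rV[R]_p -> R) (xs : 'I_n -> 'rV[R]_d)
    (y : T -> 'rV[R]_n) (x : 'rV[R]_d) : \bar R :=
  ('E_P[fun w => f x (lse f xs (y w))])%E.

Definition prediction_uncertainty (R : realType) (disp : measure_display)
    (T : measurableType disp) (P : probability T R) (d p n : nat)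
    (f : 'rV[R]_d -> 'rV[R]_p -> R) (xs : 'I_n -> 'rV[R]_d)
    (y : T -> 'rV[R]_n) (x : 'rV[R]_d) : \bar R :=
  ('V_P[fun w => f x (lse f xs (y w))])%E.

Definition biased_at (R : realType) (disp : measure_display)
    (T : measurableType disp) (P : probability T R) (d p n : nat)
    (f : 'rV[R]_d -> 'rV[R]_p -> R) (xs : 'I_n -> 'rV[R]_d)
    (y : T -> 'rV[R]_n) (x : 'rV[R]_d) : Prop :=
  expected_prediction P f xs y x <> (f x (lse f xs (mean_vector P y)))%:E.

(* Main.v *)
Require Import Defs.
From HB Require Import structures.
From mathcomp Require Import all_boot all_order all_algebra.
From mathcomp Require Import all_classical all_reals all_analysis.
From mathcomp Require Import measurable_realfun.
From mathcomp Require Import ring lra.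

Set Implicit Arguments.
Unset Strict Implicit.
Unset Printing Implicit Defensive.

Import Order.TTheory GRing.Theory Num.Theory.
Import numFieldNormedType.Exports.

Local Open Scope classical_set_scope.
Local Open Scope ring_scope.

(** Since the design points are vertices of the cube, [(x_i^(k))^2 = 1], so on the
    design the model is linear in the coefficients [a_0 = theta_0 + sum_k beta_k
    theta_k^2 / 2] and [a_k = alpha_k theta_k], which determine [theta] because
    [alpha_k <> 0].  The design is orthogonal, so the least-squares estimator of
    [a] is [a + e] with [e_j = (1/n) sum_i z_ij eps_i], where [z_i0 = 1] and
    [z_ik = x_i^(k)].  In terms of [a] the model reads
    [f(x) = a_0 + sum_k a_k x^(k) + sum_k c_k a_k^2] with
    [c_k = beta_k / (2 alpha_k^2) ((x^(k))^2 - 1)]; hence the prediction error is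
    [L + sum_k c_k e_k^2] with [L] a linear form in the noise.  Its first two
    moments follow from Isserlis' formula for products of at most four Gaussian
    linear forms. *)

(** * Integration against a measure given by a map and a weight *)

Section pushforward_weight.
Import HBNNSimple.

(** The hypothesis on [nu] is the claim for indicators; it passes to simple functions by linearity
    and to [f] by monotone convergence. It is used with [X i0] weighted by the other factors of a
    product, and with the identity weighted by the normal density. *)
Lemma ge0_integral_pushforward_weight (R : realType) (d1 d2 : measure_display)
    (X : measurableType d1) (Y : measurableType d2)
    (mu : {measure set X -> \bar R}) (nu : {measure set Y -> \bar R})
    (phi : X -> Y) (w : X -> R) (f : Y -> \bar R) :
  measurable_fun setT phi -> measurable_fun setT w -> (forall x, 0 <= w x) ->
  (forall B, measurable B -> nu B = \int[mu]_(x in phi @^-1` B) (w x)%:E)%E ->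
  measurable_fun setT f -> (forall y, 0 <= f y)%E ->
  (\int[nu]_y f y = \int[mu]_x (f (phi x) * (w x)%:E))%E.
Proof.
move=> mphi mw w0 nuE mf f0.
pose h := nnsfun_approx measurableT mf.
have mhphi n : measurable_fun setT (fun x => (h n (phi x))%:E).
  by apply/measurable_EFinP; exact: measurableT_comp.
have hf y : (h n y)%:E @[n --> \oo] --> f y.
  by apply: cvg_nnsfun_approx => // x _; exact: f0.
have -> : (\int[nu]_y f y = limn (fun n => \int[nu]_y (h n y)%:E))%E.
  rewrite -monotone_convergence//.
  - by apply: eq_integral => y _; apply/esym/cvg_lim => //; exact: hf.
  - by move=> n; exact/measurable_EFinP.
  - by move=> n x _; rewrite lee_fin.
  - by move=> x _ a b ab; rewrite lee_fin; exact/lefP/nd_nnsfun_approx.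
have -> : (\int[mu]_x (f (phi x) * (w x)%:E) =
    limn (fun n => \int[mu]_x ((h n (phi x))%:E * (w x)%:E)))%E.
  rewrite -monotone_convergence//.
  - apply: eq_integral => x _; apply/esym/cvg_lim => //.
    by apply: cvgeZr => //; exact: hf.
  - by move=> n; apply: emeasurable_funM => //; exact/measurable_EFinP.
  - by move=> n x _; rewrite -EFinM lee_fin mulr_ge0.
  - move=> x _ a b ab; rewrite -!EFinM lee_fin ler_wpM2r//.
    exact/lefP/nd_nnsfun_approx.
congr (limn _); apply/funext => n.
rewrite integralT_nnsfun sintegralE.
have mpre r : measurable (phi @^-1` (h n @^-1` [set r])).
  by rewrite -[X in measurable X]setTI; exact: mphi.
transitivity (\int[mu]_x ((\sum_(r \in range (h n))
    (r * \1_(phi @^-1` (h n @^-1` [set r])) x)%:E) * (w x)%:E))%E; last first.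
  apply: eq_integral => x _; congr (_ * _)%E.
  by rewrite fimfunE -fsumEFin.
transitivity (\int[mu]_x (\sum_(r \in range (h n))
    ((r * \1_(phi @^-1` (h n @^-1` [set r])) x)%:E * (w x)%:E)))%E; last first.
  apply: eq_integral => x _; rewrite ge0_mule_fsuml// => r.
  exact: (nnfun_muleindic_ge0 (h n) r (phi x)).
rewrite ge0_integral_fsum//; last 2 first.
- move=> r; apply: emeasurable_funM; apply/measurable_EFinP => //.
  exact: measurable_funM.
- move=> r x _; rewrite mule_ge0 ?lee_fin//.
  exact: (nnfun_muleindic_ge0 (h n) r (phi x)).
apply: eq_fsbigr => r; rewrite inE => -[y _ <-].
rewrite nuE//.
under [RHS]eq_integral do rewrite EFinM -muleA.
rewrite ge0_integralZl//.
- congr (_ * _)%E; rewrite -[in LHS](setTI (phi @^-1` _)) integral_mkcondr.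
  by apply: eq_integral => x _; rewrite muleC epatch_indic.
- apply: emeasurable_funM; apply/measurable_EFinP => //.
- by move=> x _; rewrite -EFinM lee_fin mulr_ge0.
- by rewrite lee_fin.
Qed.
End pushforward_weight.

(** * Integrable random variables and their means *)

Lemma max0_subN (R : realDomainType) (x : R) :
  Num.max x 0 - Num.max (- x) 0 = x.
Proof.
have [x0|x0] := leP x 0; first by rewrite sub0r max_l ?opprK// oppr_ge0.
by rewrite max_r ?subr0// oppr_le0 ltW.
Qed.

(** Integrability is kept together with the value because additivity and scaling of ['E_P] both
    require it; means then combine without side conditions. *)
Definition has_mean (R : realType) (disp : measure_display)
    (T : measurableType disp) (P : probability T R) (X : T -> R) (m : R) : Prop :=
  P.-integrable setT (EFin \o X) /\ 'E_P[X]%E = m%:E.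

Section mean.
Context (R : realType) (disp : measure_display) (T : measurableType disp).
Variable P : probability T R.
Implicit Types (X Y : T -> R) (m : R).

Lemma has_mean_eq X Y m m' : has_mean P X m -> X =1 Y -> m = m' ->
  has_mean P Y m'.
Proof. by move=> XP /funext <- <-. Qed.

Lemma ge0_has_mean X m : measurable_fun setT X -> (forall t, 0 <= X t) ->
  (\int[P]_t (X t)%:E = m%:E)%E -> has_mean P X m.
Proof.
move=> mX X0 EX; split; last by rewrite unlock.
apply/integrableP; split; first exact/measurable_EFinP.
under eq_integral do rewrite /= ger0_norm//.
by rewrite EX ltry.
Qed.

Lemma has_mean_cst m : has_mean P (cst m) m.
Proof.
split; last exact: expectation_cst.
by apply: finite_measure_integrable_cst.
Qed.

Lemma has_meanD X Y m m' : has_mean P X m -> has_mean P Y m' ->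
  has_mean P (fun t => X t + Y t) (m + m').
Proof.
move=> [iX EX] [iY EY]; split.
  exact: (integrableD measurableT iX iY).
by rewrite -[LHS]/('E_P[X \+ Y])%E expectationD ?EX ?EY//;
  exact/Lfun1_integrable.
Qed.

Lemma has_meanZ X m c : has_mean P X m -> has_mean P (fun t => c * X t) (c * m).
Proof.
move=> [iX EX]; split.
  exact: (integrableZl measurableT c iX).
rewrite (_ : (fun t => c * X t) = c \o* X); last first.
  by apply/funext => t /=; rewrite mulrC.
by rewrite expectationZl ?EX//; exact/Lfun1_integrable.
Qed.

Lemma has_meanB X Y m m' : has_mean P X m -> has_mean P Y m' ->
  has_mean P (fun t => X t - Y t) (m - m').
Proof.
move=> hX /(has_meanZ (-1)) hY.
by apply: has_mean_eq (has_meanD hX hY) _ _ => [t|]; rewrite mulN1r.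
Qed.

Lemma has_mean_sum (I : Type) (s : seq I) (X : I -> T -> R) (m : I -> R) :
  (forall i, has_mean P (X i) (m i)) ->
  has_mean P (fun t => \sum_(i <- s) X i t) (\sum_(i <- s) m i).
Proof.
move=> hX; elim: s => [|i s IH].
  by apply: has_mean_eq (has_mean_cst 0) _ _ => [t|]; rewrite big_nil.
by apply: has_mean_eq (has_meanD (hX i) IH) _ _ => [t|]; rewrite big_cons.
Qed.

Lemma integrable_has_mean X : P.-integrable setT (EFin \o X) ->
  has_mean P X (fine 'E_P[X])%E.
Proof.
move=> iX; split=> //; rewrite fineK// expectation_fin_num//.
exact/Lfun1_integrable.
Qed.

Lemma has_mean_integral X m : has_mean P X m ->
  (\int[P]_t (X t)%:E = m%:E)%E.
Proof. by case=> _; rewrite unlock. Qed.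

Lemma has_mean_pos X m : has_mean P X m ->
  exists m', has_mean P (fun t => Num.max (X t) 0) m'.
Proof.
move=> [iX _]; eexists; apply: integrable_has_mean.
apply: eq_integrable (integrable_funepos measurableT iX) => //= t _.
by rewrite /= funeposE EFin_max.
Qed.

End mean.

(** * Expectation of a product of independent variables *)

Section independence.
Context (R : realType) (disp : measure_display) (T : measurableType disp).
Context (P : probability T R) (I : finType) (X : I -> {RV P >-> R}).
Hypothesis X_indep : mutually_independent P (fun i => X i : T -> R).

(** A product of indicators is the indicator of the intersection of the events, so this is the
    definition of independence with [J] the whole of [I]. *)
Lemma has_mean_indic_prod (B : I -> set R) (c : I -> R) :
  (forall i, measurable (B i)) ->
  (forall i, has_mean P (\1_(B i) \o X i) (c i)) ->
  has_mean P (fun t => \prod_i \1_(B i) (X i t)) (\prod_i c i).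
Proof.
move=> mB hB.
have mXB i : measurable (X i @^-1` B i).
  by rewrite -[X in measurable X]setTI; exact: measurable_funPT.
have cE i : ((c i)%:E = P (X i @^-1` B i))%E.
  rewrite -(has_mean_integral (hB i)) -[in RHS](setIT (X i @^-1` B i)) -integral_indic//.
pose D := \bigcap_(i in [set` [set: I]%SET]) (X i @^-1` B i).
have mD : measurable D.
  by apply: fin_bigcap_measurable => // i _; exact: mXB.
have prodE t : \prod_i \1_(B i) (X i t) = \1_D t :> R.
  rewrite [RHS]indicE; have [tD|tD] := boolP (t \in D).
    rewrite big1// => i _; rewrite indicE mem_set//.
    by move: tD; rewrite inE; apply; rewrite /= inE.
  have [i tBi] : exists i, ~ B i (X i t).
    apply/existsNP => tB; case/negP: tD; rewrite inE => i _; exact: tB.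
  by rewrite (bigD1 i)//= indicE memNset// mul0r.
apply: has_mean_eq (_ : has_mean P \1_D _) _ _ => [|t|]; last by [].
- apply: ge0_has_mean => //.
  rewrite integral_indic// setIT -prodEFin.
  rewrite [LHS](X_indep (J := [set: I]%SET) (fun i _ => mB i)).
  by apply: eq_big => [i|i _]; rewrite ?inE.
- by rewrite prodE.
Qed.

(* Replacing the factor [h i0] by an indicator [\1_B], both sides become finite
   measures in [B]; they agree by induction, so the integrals of [h i0] agree. *)
Lemma has_mean_prod_ge0 (h : I -> R -> R) (c : I -> R) :
  (forall i, measurable_fun setT (h i)) -> (forall i x, 0 <= h i x) ->
  (forall i, has_mean P (h i \o X i) (c i)) ->
  has_mean P (fun t => \prod_i h i (X i t)) (\prod_i c i).
Proof.
move=> mh h0 hc.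
(* The induction runs over a list of indices outside which every factor is already an indicator; for
   [enum I] this condition is vacuous. *)
have : forall i, i \notin enum I -> exists2 B, measurable B & h i = \1_B.
  by move=> i; rewrite mem_enum.
elim: (enum I) => [|i0 s IH] in h c mh h0 hc *.
  move=> hB; have /choice[B mB] : forall i, exists B, measurable B /\ h i = \1_B.
    by move=> i; have [//|B mB hE] := hB i; exists B.
  have mB1 i := (mB i).1; have mB2 i := (mB i).2.
  have hcB i : has_mean P (\1_(B i) \o X i) (c i) by rewrite -mB2.
  apply: has_mean_eq (has_mean_indic_prod mB1 hcB) _ erefl => t.
  by apply: eq_bigr => i _; rewrite mB2.
move=> hB.
pose w t := \prod_(j | j != i0) h j (X j t).
pose C := \prod_(j | j != i0) c j.
have c0 j : 0 <= c j.
  rewrite -lee_fin -(hc j).2 expectation_ge0// => t; exact: h0.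
have C0 : 0 <= C by apply: prodr_ge0.
have w0 t : 0 <= w t by apply: prodr_ge0 => j _; exact: h0.
have mw : measurable_fun setT w.
  rewrite /w; under eq_fun do rewrite -big_filter.
  apply: measurable_prod => j _.
  exact: measurableT_comp.
pose nu := mscale (NngNum C0) (distribution P (X i0)).
have nuE B : measurable B ->
    (nu B = \int[P]_(t in X i0 @^-1` B) (w t)%:E)%E.
  move=> mB.
  have mXB : measurable (X i0 @^-1` B).
    by rewrite -[X in measurable X]setTI; exact: measurable_funPT.
  pose h' i := if i == i0 then \1_B else h i.
  pose c' i := if i == i0 then fine (P (X i0 @^-1` B)) else c i.
  have h'c' : has_mean P (fun t => \prod_i h' i (X i t)) (\prod_i c' i).
    apply: IH => [i|i x|i|i i_s].
    - by rewrite /h'; case: ifP => // _; exact: measurable_indic.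
    - by rewrite /h'; case: ifP.
    - rewrite /h' /c'; case: eqP => [->|//]; apply: ge0_has_mean => //.
        exact: measurableT_comp.
      rewrite fineK ?fin_num_measure//.
      by rewrite -[in RHS](setIT (X i0 @^-1` B)) -integral_indic.
    - rewrite /h'; case: eqP => [_|/eqP ii0]; first by exists B.
      by apply: hB; rewrite inE negb_or ii0.
  have wE t : \prod_i h' i (X i t) = \1_B (X i0 t) * w t.
    rewrite (bigD1 i0)//= {1}/h' eqxx; congr (_ * _).
    by apply: eq_bigr => i /negPf ii0; rewrite /h' ii0.
  have CE : \prod_i c' i = fine (P (X i0 @^-1` B)) * C.
    rewrite (bigD1 i0)//= {1}/c' eqxx; congr (_ * _).
    by apply: eq_bigr => i /negPf ii0; rewrite /c' ii0.
  have := has_mean_integral h'c'; rewrite CE EFinM fineK ?fin_num_measure//.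
  under eq_integral do rewrite wE.
  rewrite /nu /mscale/= muleC => <-.
  rewrite -[in RHS](setTI (_ @^-1` _)) integral_mkcondr.
  by apply: eq_integral => t _; rewrite epatch_indic EFinM muleC.
apply: ge0_has_mean.
- by apply: measurable_prod => j _; exact: measurableT_comp.
- by move=> t; apply: prodr_ge0 => j _; exact: h0.
have := ge0_integral_pushforward_weight (measurable_funPT (X i0)) mw w0 nuE.
move=> /(_ (EFin \o h i0)) nuw.
have mhi0 : measurable_fun setT (EFin \o h i0) by exact/measurable_EFinP.
transitivity (\int[nu]_x (h i0 x)%:E)%E.
  rewrite nuw//; last by move=> *; rewrite lee_fin.
  by apply: eq_integral => t _; rewrite (bigD1 i0)//= EFinM.
rewrite ge0_integral_mscale//=; last by move=> *; rewrite lee_fin.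
rewrite ge0_integral_distribution//; last by move=> *; rewrite lee_fin.
rewrite (has_mean_integral (hc i0)) -EFinM (bigD1 i0)//=.
by rewrite mulrC.
Qed.

(** The product is linear in each factor, so splitting factors into positive and negative parts, one
    index at a time, reduces the claim to nonnegative factors. *)
Lemma has_mean_prod (h : I -> R -> R) (c : I -> R) :
  (forall i, measurable_fun setT (h i)) ->
  (forall i, has_mean P (h i \o X i) (c i)) ->
  has_mean P (fun t => \prod_i h i (X i t)) (\prod_i c i).
Proof.
move=> mh hc.
(* Here the list collects the indices whose factor may still take negative values. *)
have : forall i, i \notin enum I -> forall x, 0 <= h i x.
  by move=> i; rewrite mem_enum.
elim: (enum I) => [|i0 s IH] in h c mh hc *.
  by move=> h0; apply: has_mean_prod_ge0 => // i; exact: h0.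
move=> h0.
have [cp hp] := has_mean_pos (hc i0).
have [cn hn] := has_mean_pos (has_meanZ (-1) (hc i0)).
have cE : c i0 = cp - cn.
  apply: EFin_inj; rewrite -(hc i0).2 -(has_meanB hp hn).2.
  by congr ('E_P[_])%E; apply/funext => t /=; rewrite mulN1r max0_subN.
pose rep (A : Type) (f : I -> A) a i := if i == i0 then a else f i.
have repE (f : I -> R) a :
    \prod_i rep _ f a i = a * \prod_(i | i != i0) f i.
  rewrite (bigD1 i0)//= {1}/rep eqxx; congr (_ * _).
  by apply: eq_bigr => i /negPf ii0; rewrite /rep ii0.
have IH1 (g : R -> R) (a : R) : measurable_fun setT g -> (forall x, 0 <= g x) ->
    has_mean P (g \o X i0) a ->
    has_mean P (fun t => g (X i0 t) * \prod_(i | i != i0) h i (X i t))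
      (a * \prod_(i | i != i0) c i).
  move=> mg g0 ga; have := IH (rep _ h g) (rep _ c a).
  rewrite repE => hm; apply: has_mean_eq (hm _ _ _) _ erefl.
  - by move=> i; rewrite /rep; case: eqP.
  - by move=> i; rewrite /rep; case: eqP => // ->.
  - move=> i i_s x; rewrite /rep; case: eqP => [//|/eqP ii0].
    by apply: h0; rewrite inE negb_or ii0.
  - move=> t; rewrite -repE; apply: eq_bigr => i _.
    by rewrite /rep; case: eqP => // ->.
have max_ge0 (x : R) : 0 <= Num.max x 0 by rewrite le_max lexx orbT.
have hP := IH1 (fun x => Num.max (h i0 x) 0) cp _ (fun=> max_ge0 _) hp.
have hN := IH1 (fun x => Num.max (-1 * h i0 x) 0) cn _ (fun=> max_ge0 _) hn.
apply: has_mean_eq (has_meanB (hP _) (hN _)) _ _.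
- exact: measurable_maxr.
- by apply: measurable_maxr => //; exact: measurable_funM.
- by move=> t; rewrite -mulrBl mulN1r max0_subN [RHS](bigD1 i0).
- by rewrite -mulrBl -cE [RHS](bigD1 i0).
Qed.

End independence.

(** * Moments of the centred normal density *)

Section normal_moments.
Context (R : realType) (s : R).
Hypothesis s0 : s != 0.
Local Notation mu := (@lebesgue_measure R).
Local Notation phi := (normal_pdf 0 s).

Let phiE (x : R) : phi x = normal_peak s * expR (- (x ^+ 2 / (s ^+ 2 *+ 2))).
Proof. by rewrite normal_pdfE// /normal_fun subr0 mulNr. Qed.

(** This makes [- s ^+ 2 * phi x] an antiderivative of [x * phi x], which drives the integration by
    parts below. *)
Lemma is_derive_normal_pdf0 (x : R) :
  is_derive x 1 (normal_pdf 0 s : R -> R) (- (x / s ^+ 2 * phi x)).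
Proof.
have -> : normal_pdf 0 s =
    (fun x : R => normal_peak s * expR (- (x ^+ 2 / (s ^+ 2 *+ 2)))).
  by apply/funext => y; rewrite phiE.
apply: is_derive_eq; rewrite /GRing.scale/=; field.
by rewrite s0.
Qed.

(** These are the boundary terms of the integration by parts. With y = n^2 / (2 s^2), the
    exponential series bounds [expR (- y)] by (k+1)! / y^(k+1), so the product is of order 1 /
    n^(k+1). *)
Lemma cvgn_exprM_normal_pdf (k : nat) :
  (n%:R ^+ k.+1 * phi n%:R) @[n --> \oo] --> (0 : R).
Proof.
(* [K] gathers the factors independent of n in the bound K / n^(k+1), which is then weakened to K /
   n. *)
pose K := normal_peak s * (k.+1)`!%:R * (s ^+ 2 *+ 2) ^+ k.+1.
rewrite -(cvg_shiftS (fun n => n%:R ^+ k.+1 * phi n%:R)).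
apply: (@squeeze_cvgr _ _ _ _ (cst 0) (fun n => K * n.+1%:R^-1)).
- near=> n; apply/andP; split.
    by rewrite mulr_ge0// normal_pdf_ge0.
  have n0 : 0 < n.+1%:R :> R by [].
  pose y : R := n.+1%:R ^+ 2 / (s ^+ 2 *+ 2).
  have s20 : 0 < s ^+ 2 *+ 2 by rewrite pmulrn_lgt0// exprn_even_gt0.
  have y0 : 0 < y by rewrite divr_gt0// exprn_gt0.
  have ey : expR (- y) <= (k.+1)`!%:R / y ^+ k.+1.
    rewrite expRN -[leRHS]invf_div lef_pV2 ?posrE ?expR_gt0//; last first.
      by rewrite divr_gt0 ?exprn_gt0// ltr0n fact_gt0.
    by apply: le_trans (expR_ge1Dxn k (ltW y0)); rewrite lerDr.
  rewrite /= phiE -/y;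
  rewrite mulrCA /K -!mulrA ler_wpM2l ?normal_peak_ge0//.
  apply: (@le_trans _ _ (n.+1%:R ^+ k.+1 * ((k.+1)`!%:R / y ^+ k.+1))).
    by rewrite ler_wpM2l// exprn_ge0.
  rewrite mulrCA ler_wpM2l// /y expr_div_n invf_div mulrCA ler_wpM2l//.
    by rewrite exprn_ge0// ltW.
  rewrite -exprM mul2n -addnn exprD invfM mulrA divff ?mul1r; last first.
    by rewrite expf_neq0// gt_eqF.
  rewrite exprS invfM ler_piMr// ?invr_ge0// invf_le1 ?exprn_gt0//.
  by rewrite exprn_ege1// ler1n.
- exact: cvg_cst.
- rewrite -(mulr0 K); apply: cvgM; first exact: cvg_cst.
  exact: cvg_harmonic.
Unshelve. all: by end_near.
Qed.

Let J k n := (\int[mu]_(x in `[0%R, n%:R]) (x ^+ k * phi x)%:E)%E.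

(** Integration by parts of x^(k+1) against x phi(x) on [0, n]. The boundary term at 0 vanishes
    because k+1 is positive; the one at n is kept. *)
Lemma integral0n_normal_rec (k n : nat) : (0 < n)%N ->
  (J k.+2 n = (- (s ^+ 2 * (n%:R ^+ k.+1 * phi n%:R)))%:E
              + (k.+1%:R * s ^+ 2)%:E * J k n)%E.
Proof.
move=> n0.
have cphi : continuous phi by exact: continuous_normal_pdf.
have dphi (x : R) : derivable phi x 1 by have [] := is_derive_normal_pdf0 x.
have cX m : continuous (fun x : R => x ^+ m) by exact: exprn_continuous.
have dLR (F : R -> R) : (forall x, derivable F x 1) ->
    derivable_oo_LRcontinuous F 0 n%:R.
  move=> dF; have cF : continuous F.
    by move=> x; apply/differentiable_continuous/derivable1_diffP.
  split=> [x _||]; first exact: dF.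
    by apply: cvg_at_right_filter; exact: cF.
  by apply: cvg_at_left_filter; exact: cF.
have := @integration_by_parts R (fun x => x ^+ k.+1) (fun x => - s ^+ 2 * phi x)
  (fun x => k.+1%:R * x ^+ k) (fun x => x * phi x) 0 n%:R.
have -> : (J k.+2 n = \int[mu]_(x in `[0%R, n%:R]) (x ^+ k.+1 * (x * phi x))%:E)%E.
  by apply: eq_integral => x _; rewrite mulrA -exprSr.
move=> ->.
- rewrite expr0n/= mul0r subr0 mulNr mulrN mulrCA; congr (_ + _)%E.
  rewrite /J -ge0_integralZl//=.
  + rewrite -[RHS]oppeK; congr (- _)%E; rewrite -integral_ge0N//=; last first.
      move=> x; rewrite in_itv/= => /andP[x0 _].
      rewrite -EFinM lee_fin; apply: mulr_ge0.
        by rewrite mulr_ge0 ?sqr_ge0.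
      by rewrite mulr_ge0 ?normal_pdf_ge0 ?exprn_ge0.
    apply: eq_integral => x _.
    by congr EFin; ring.
  + apply/measurable_EFinP/measurable_funTS/measurable_funM.
      exact: measurable_funX.
    exact: measurable_normal_pdf.
  + move=> x; rewrite in_itv/= => /andP[x0 _].
    by rewrite lee_fin mulr_ge0 ?normal_pdf_ge0// exprn_ge0.
  + by rewrite lee_fin mulr_ge0// sqr_ge0.
- by rewrite ltr0n.
- apply: continuous_subspaceT => x.
  by apply: cvgM; [exact: cvg_cst|exact: cX].
- by apply: dLR => x; apply: exprn_derivable.
- move=> x _; by rewrite exp_derive1.
- apply: continuous_subspaceT => x.
  by apply: cvgM; [exact: cvg_id|exact: cphi].
- apply: dLR => x; apply: derivableM => //.
- move=> x _; rewrite derive1E deriveM// derive_cst scaler0 addr0.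
  rewrite (@derive_val _ _ _ _ _ _ _ (is_derive_normal_pdf0 x)) /GRing.scale/=.
  by field.
Qed.

Definition normal_moment (k : nat) : \bar R := (\int[mu]_x (x ^+ k * phi x)%:E)%E.

(** For an even power the integrand is even and nonnegative, so the moment is twice the half-line
    integral, the limit of the truncated integrals [J]; the recursion passes to the limit as its
    boundary term tends to 0. Nonnegativity allows this in the extended reals, before finiteness is
    known. *)
Lemma normal_moment_rec (k : nat) : ~~ odd k ->
  (normal_moment k.+2 = (k.+1%:R * s ^+ 2)%:E * normal_moment k)%E.
Proof.
move=> ek.
have halve m : ~~ odd m -> (normal_moment m =
    2%:E * \int[mu]_(x in `[0%R, +oo[) (x ^+ m * phi x)%:E)%E.
  move=> em; rewrite /normal_moment ge0_symfun_integralT//.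
  - congr (_ * \int[mu]_(x in _) _)%E; apply/seteqP.
    by split => x/=; rewrite in_itv/= andbT.
  - by move=> x; rewrite mulr_ge0 ?normal_pdf_ge0// exprn_even_ge0.
  - move=> x; apply: cvgM; first exact: exprn_continuous.
    exact: continuous_normal_pdf.
  - by move=> x/=; rewrite exprNn -signr_odd (negPf em) mul1r !phiE sqrrN.
rewrite !halve//= ?negbK// muleCA; congr (_ * _)%E.
have cvgJ m : ~~ odd m -> J m n @[n --> \oo] -->
    (\int[mu]_(x in `[0%R, +oo[) (x ^+ m * phi x)%:E)%E.
  move=> em; apply: ge0_cvgn_integral.
    by move=> x; rewrite mulr_ge0 ?normal_pdf_ge0// exprn_even_ge0.
  apply: measurable_funM; first exact: measurable_funX.
  exact: measurable_normal_pdf.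
have c1 := cvgJ k.+2.
have c2 : ((- (s ^+ 2 * (n%:R ^+ k.+1 * phi n%:R)))%:E
    + (k.+1%:R * s ^+ 2)%:E * J k n)%E @[n --> \oo] -->
    (0 + (k.+1%:R * s ^+ 2)%:E *
      (\int[mu]_(x in `[0%R, +oo[) (x ^+ k * phi x)%:E))%E.
  apply: cvgeD.
  - by rewrite fin_num_adde_defr.
  - apply: cvg_EFin; first by near=> n.
    suff : - (s ^+ 2 * (n%:R ^+ k.+1 * phi n%:R)) @[n --> \oo] -->
        - (s ^+ 2 * 0) by rewrite mulr0 oppr0.
    by apply: cvgN; apply: cvgM; [exact: cvg_cst|exact: cvgn_exprM_normal_pdf].
  - by apply: cvgeZl => //; exact: cvgJ.
rewrite add0e in c2.
apply: (cvg_unique _ (c1 _)) => //=; first by rewrite negbK.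
(* Both sequences are shifted by one because the truncated recursion requires 0 < n. *)
rewrite -(cvg_shiftS (J k.+2)).
rewrite -cvg_shiftS in c2.
apply: cvg_trans c2; apply: near_eq_cvg; near=> n.
by rewrite /= integral0n_normal_rec.
Unshelve. all: by end_near.
Qed.

End normal_moments.

(** The moments of N(0, s^2), namely (k-1)!! s^k for even k and 0 for odd k, in the recursive form
    that integration by parts produces. *)
Fixpoint centered_normal_moment (R : realType) (s : R) (k : nat) : R :=
  match k with
  | 0 => 1
  | 1 => 0
  | k'.+2 => k'.+1%:R * s ^+ 2 * centered_normal_moment s k'
  end.

Lemma centered_normal_moment_odd (R : realType) (s : R) (k : nat) :
  odd k -> centered_normal_moment s k = 0.
Proof.
elim/ltn_ind: k => -[|[|k]] //= IH ok.
by rewrite IH ?mulr0//; rewrite negbK in ok.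
Qed.

(** * Moments of a normal random variable *)

Section normal_random_variable.
Context (R : realType) (disp : measure_display) (T : measurableType disp).
Context (P : probability T R) (X : {RV P >-> R}) (s : R).
Hypothesis s0 : s != 0.
Hypothesis X_normal : forall B : set R, measurable B ->
  distribution P X B = normal_prob 0 s B.
Local Notation mu := (@lebesgue_measure R).

Lemma ge0_integral_normal_rv (g : R -> R) : measurable_fun setT g ->
  (forall x, 0 <= g x) ->
  (\int[P]_t (g (X t))%:E = \int[mu]_x (g x * normal_pdf 0 s x)%:E)%E.
Proof.
move=> mg g0.
have mEg : measurable_fun setT (EFin \o g) by exact/measurable_EFinP.
rewrite -(@ge0_integral_distribution _ _ _ _ _ P X (EFin \o g))//.
rewrite (@ge0_integral_pushforward_weight R _ _ _ _ mu (distribution P X)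
  idfun (normal_pdf 0 s))//.
- by move=> _ B mB; rewrite setTI.
- exact: measurable_normal_pdf.
- by move=> x; exact: normal_pdf_ge0.
Qed.

(** The density is even and Lebesgue measure is invariant under negation, so the law is
    symmetric. *)
Lemma ge0_integral_normal_rvN (g : R -> R) : measurable_fun setT g ->
  (forall x, 0 <= g x) ->
  (\int[P]_t (g (X t))%:E = \int[P]_t (g (- X t))%:E)%E.
Proof.
move=> mg g0.
have mgN : measurable_fun setT (fun x : R => g (- x)) by exact: measurableT_comp.
rewrite ge0_integral_normal_rv// (ge0_integral_normal_rv mgN)//.
have mgp : measurable_fun setT (fun x : R => (g x * normal_pdf 0 s x)%:E).
  by apply/measurable_EFinP/measurable_funM => //; exact: measurable_normal_pdf.
transitivity (\int[pushforward mu (-%R : _ -> measurableTypeR R)]_x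
    (g x * normal_pdf 0 s x)%:E)%E.
  by apply: eq_measure_integral => //= A mA _; exact/esym/lebesgue_measureN.
rewrite ge0_integral_pushforward//=.
- rewrite preimage_setT; apply: eq_integral => x _ /=.
  by rewrite !normal_pdfE// /normal_fun !subr0 sqrrN.
- by move=> x _; rewrite lee_fin mulr_ge0 ?normal_pdf_ge0.
Qed.

Lemma has_mean_normal_expr_even (k : nat) : ~~ odd k ->
  has_mean P (fun t => X t ^+ k) (centered_normal_moment s k).
Proof.
move=> ek.
have mexp : measurable_fun setT (fun x : R => x ^+ k) by exact: measurable_funX.
have exp_ge0 (x : R) : 0 <= x ^+ k by exact: exprn_even_ge0.
apply: ge0_has_mean => //; first exact: measurable_funX.
rewrite (ge0_integral_normal_rv mexp)//.
rewrite -/(normal_moment s k).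
elim/ltn_ind: k ek {mexp exp_ge0} => -[_ _|[//|k IH]] /=.
  rewrite /normal_moment -(integral_normal_pdf 0 s).
  by apply: eq_integral => x _; rewrite mul1r.
by rewrite negbK => ek; rewrite normal_moment_rec// IH// EFinM.
Qed.

(** For odd k, negating the variable exchanges the positive and negative parts of the power, so by
    symmetry of the law they have the same mean and cancel. *)
Lemma has_mean_normal_expr (k : nat) :
  has_mean P (fun t => X t ^+ k) (centered_normal_moment s k).
Proof.
have [ok|] := boolP (odd k); last exact: has_mean_normal_expr_even.
rewrite centered_normal_moment_odd//.
(* Integrability for odd k comes from |x|^k <= 1 + x^(k+1), where the exponent k+1 is even. *)
have iXk : P.-integrable setT (EFin \o (fun t => X t ^+ k)).
  have ek1 : ~~ odd k.+1 by rewrite /= negbK.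
  have [i1 _] := has_meanD (has_mean_cst P 1) (has_mean_normal_expr_even ek1).
  apply: le_integrable i1 => //.
    by apply/measurable_EFinP/measurable_funX.
  move=> t _ /=; rewrite lee_fin normrX.
  rewrite [leRHS]ger0_norm ?addr_ge0 ?exprn_even_ge0//.
  rewrite -(@ger0_norm _ (X t ^+ k.+1)) ?exprn_even_ge0// normrX.
  have [x1|x1] := leP `|X t| 1.
    by rewrite (le_trans (exprn_ile1 _ _ x1))// lerDl exprn_ge0.
  rewrite exprS (le_trans (ler_peMl _ (ltW x1)))// ?exprn_ge0//.
  by rewrite lerDr.
have hX := integrable_has_mean iXk.
set m := fine _ in hX.
pose g (x : R) := Num.max (x ^+ k) 0.
have [p hp] := has_mean_pos hX.
have hn : has_mean P (fun t => Num.max (-1 * X t ^+ k) 0) p.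
  have gN t : Num.max (-1 * X t ^+ k) 0 = g (- X t).
    by rewrite /g exprNn -signr_odd ok expr1.
  apply: ge0_has_mean.
  - by apply: measurable_maxr => //; apply: measurable_funM => //; exact: measurable_funX.
  - by move=> t; rewrite le_max lexx orbT.
  under eq_integral do rewrite gN.
  rewrite -ge0_integral_normal_rvN ?(has_mean_integral hp)//.
  - by apply: measurable_maxr => //; exact: measurable_funX.
  - by move=> x; rewrite le_max lexx orbT.
apply: has_mean_eq (has_meanB hp hn) _ (subrr p) => t.
by rewrite mulN1r max0_subN.
Qed.

End normal_random_variable.

(** * Moments of Gaussian linear forms up to order four *)

Lemma sumr_delta (R : pzRingType) (I : finType) (F : I -> R) (i : I) :
  \sum_j F j * (i == j)%:R = F i.
Proof.
rewrite (bigD1 i)//= eqxx mulr1 big1 ?addr0// => j ji.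
by rewrite eq_sym (negPf ji) mulr0.
Qed.

Section gaussian_forms.
Context (R : realType) (disp : measure_display) (T : measurableType disp).
Context (P : probability T R) (I : finType) (X : I -> {RV P >-> R}) (s : R).
Hypothesis s0 : s != 0.
Hypothesis X_indep : mutually_independent P (fun i => X i : T -> R).
Hypothesis X_normal : forall (i : I) (B : set R), measurable B ->
  distribution P (X i) B = normal_prob 0 s B.

Let M (l : seq I) : R := \prod_r centered_normal_moment s (count_mem r l).

(** Equal indices are grouped into powers, [X r] getting its multiplicity in [l] as exponent, and
    independence then factors the mean. *)
Lemma has_mean_monomial (l : seq I) : has_mean P (fun t => \prod_(i <- l) X i t)
  (\prod_r centered_normal_moment s (count_mem r l)).
Proof.
have := has_mean_prod X_indep (h := fun r x => x ^+ count_mem r l).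
move=> /(_ (fun r => centered_normal_moment s (count_mem r l)) _ _) hl.
apply: has_mean_eq (hl _ _) _ erefl.
- by move=> r; exact: measurable_funX.
- by move=> r; exact: (has_mean_normal_expr s0 (X_normal r)).
move=> t /=; elim: l {hl} => [|i l IH]; first by rewrite big_nil big1.
rewrite big_cons -IH [LHS](eq_bigr (fun r => X r t ^+ (i == r) * X r t ^+ count_mem r l));
  last by move=> r _; rewrite /=; rewrite exprD.
rewrite big_split/=; congr (_ * _).
rewrite (bigD1 i)//= eqxx expr1 big1 ?mulr1// => r ri.
by rewrite eq_sym (negPf ri).
Qed.

Let M_odd r l : odd (count_mem r l) -> M l = 0.
Proof.
by move=> rl; rewrite /M (bigD1 r)//= centered_normal_moment_odd ?mul0r.
Qed.

Let M2 i j : M [:: i; j] = s ^+ 2 * (i == j)%:R.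
Proof.
have [<-|ij] := eqVneq i j; last first.
  by rewrite (@M_odd i) ?mulr0//= eqxx eq_sym (negPf ij).
rewrite /M (bigD1 i)//= !eqxx/= big1 ?mulr1 ?mul1r// => r ri.
by rewrite eq_sym (negPf ri).
Qed.

Let M4_pairs i j : i != j -> M [:: i; i; j; j] = s ^+ 4.
Proof.
move=> ij; have ji : j != i by rewrite eq_sym.
rewrite /M (bigD1 i)//= (bigD1 j)//= !eqxx (negPf ij) (negPf ji)/=.
rewrite big1 => [|r /andP[ri rj]]; first by ring.
by rewrite ![_ == r]eq_sym (negPf ri) (negPf rj).
Qed.

Let M_perm l l' : perm_eq l l' -> M l = M l'.
Proof. by move=> /permP ll'; apply: eq_bigr => r _; rewrite ll'. Qed.

(** Isserlis' formula for the coordinates, by cases on which indices agree. Only even multiplicities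
    survive: two distinct pairs match exactly one of the three pairings, and four equal indices
    match all three, in accordance with the fourth moment 3 s^4. *)
Let M4 i j k l : M [:: i; j; k; l] = s ^+ 4 *
  ((i == j)%:R * (k == l)%:R + (i == k)%:R * (j == l)%:R
   + (i == l)%:R * (j == k)%:R).
Proof.
have [<-|ij] := eqVneq i j.
  have [<-|kl] := eqVneq k l.
    have [<-|ik] := eqVneq i k.
      rewrite /M (bigD1 i)//= !eqxx/= big1 => [|r ri]; first by ring.
      by rewrite eq_sym (negPf ri).
    by rewrite M4_pairs//=; ring.
  have [ik|ik] := eqVneq i k.
    have il : (i == l) = false by rewrite ik (negPf kl).
    rewrite (@M_odd l) /= ?il; first by rewrite !(mulr0, mul0r, addr0).
    by rewrite eqxx (negPf kl).
  rewrite (@M_odd k) /=; first by rewrite !(mulr0, mul0r, addr0).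
  by rewrite eqxx (negPf ik) eq_sym (negPf kl).
have ji : (j == i) = false by rewrite eq_sym (negPf ij).
have [<-|ik] := eqVneq i k.
  have [<-|jl] := eqVneq j l.
    rewrite (@M_perm _ [:: i; i; j; j]) ?M4_pairs//=; first by rewrite (negPf ij) !(mul0r, addr0, add0r, mulr1).
    by rewrite /= perm_cons (perm_catCA [:: j] [:: i] [:: j]).
  rewrite (@M_odd j) /=; first by rewrite ji !(mulr0, mul0r, addr0).
  by rewrite eqxx (negPf ij) eq_sym (negPf jl).
have [<-|il] := eqVneq i l.
  have [<-|jk] := eqVneq j k.
    rewrite (@M_perm _ [:: i; i; j; j]) ?M4_pairs//=; first by rewrite !(mul0r, addr0, add0r, mulr1).
    by rewrite /= perm_cons (perm_catC [:: j; j] [:: i]).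
  rewrite (@M_odd j) /=; first by rewrite !(mulr0, mul0r, addr0).
  by rewrite eqxx (negPf ij) eq_sym (negPf jk).
rewrite (@M_odd i) /=; first by rewrite !(mulr0, mul0r, addr0).
by rewrite eqxx ![_ == i]eq_sym (negPf ij) (negPf ik) (negPf il).
Qed.

Definition linear_form (a : I -> R) (t : T) : R := \sum_i a i * X i t.
Definition dot (a b : I -> R) : R := \sum_i a i * b i.
Local Notation L := linear_form.

Lemma has_mean_linear_form (a : I -> R) : has_mean P (L a) 0.
Proof.
have h1 i : has_mean P (X i) 0.
  by have := has_mean_normal_expr s0 (X_normal i) 1.
apply: has_mean_eq (has_mean_sum (index_enum I) (fun i => has_meanZ (a i) (h1 i))) _ _ => //.
by rewrite big1// => i _; rewrite mulr0.
Qed.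

Lemma has_mean_linear_form2 (a b : I -> R) :
  has_mean P (fun t => L a t * L b t) (s ^+ 2 * dot a b).
Proof.
have h i j : has_mean P (fun t => X i t * X j t) (s ^+ 2 * (i == j)%:R).
  apply: has_mean_eq (has_mean_monomial [:: i; j]) _ (M2 i j) => t.
  by rewrite !big_cons big_nil mulr1.
have h1 i : has_mean P (fun t => X i t * L b t) (s ^+ 2 * b i).
  apply: has_mean_eq (has_mean_sum _ (fun j => has_meanZ (b j) (h i j))) _ _ => [t|].
    by rewrite mulr_sumr; apply: eq_bigr => j _; ring.
  rewrite -(sumr_delta b i) mulr_sumr.
  by apply: eq_bigr => j _; ring.
apply: has_mean_eq (has_mean_sum _ (fun i => has_meanZ (a i) (h1 i))) _ _ => [t|].
  by rewrite mulr_suml; apply: eq_bigr => j _; ring.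
by rewrite mulr_sumr; apply: eq_bigr => j _; ring.
Qed.

(** Among three indices one always has odd multiplicity, so every monomial of degree three has mean
    0. *)
Lemma has_mean_linear_form3 (a b c : I -> R) :
  has_mean P (fun t => L a t * L b t * L c t) 0.
Proof.
have M3 i j k : M [:: i; j; k] = 0.
  have [ij|ij] := eqVneq i j.
    by rewrite (@M_odd k)//= ij eqxx addn0; case: eqP.
  have [ik|ik] := eqVneq i k.
    by rewrite (@M_odd j)//= ik eqxx addn0; case: eqP.
  by rewrite (@M_odd i)//= eqxx ![_ == i]eq_sym (negPf ij) (negPf ik).
have h i j k : has_mean P (fun t => X i t * X j t * X k t) 0.
  apply: has_mean_eq (has_mean_monomial [:: i; j; k]) _ (M3 i j k) => t.
  by rewrite !big_cons big_nil mulr1 mulrA.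
have h1 i j : has_mean P (fun t => X i t * X j t * L c t) 0.
  apply: has_mean_eq (has_mean_sum _ (fun k => has_meanZ (c k) (h i j k))) _ _ => [t|].
    by rewrite mulr_sumr; apply: eq_bigr => k _; ring.
  by rewrite big1// => k _; rewrite mulr0.
have h2 i : has_mean P (fun t => X i t * L b t * L c t) 0.
  apply: has_mean_eq (has_mean_sum _ (fun j => has_meanZ (b j) (h1 i j))) _ _ => [t|].
    by rewrite [L b t]/L mulr_sumr mulr_suml; apply: eq_bigr => j _; ring.
  by rewrite big1// => j _; rewrite mulr0.
apply: has_mean_eq (has_mean_sum _ (fun i => has_meanZ (a i) (h2 i))) _ _ => [t|].
  by rewrite [L a t]/L !mulr_suml; apply: eq_bigr => i _; ring.
by rewrite big1// => i _; rewrite mulr0.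
Qed.

(** The forms are expanded one at a time, from the last to the first; each Kronecker delta of the
    coordinate formula contracts a sum, leaving the three pairings of the forms. *)
Lemma has_mean_linear_form4 (a b c d : I -> R) :
  has_mean P (fun t => L a t * L b t * L c t * L d t)
    (s ^+ 4 * (dot a b * dot c d + dot a c * dot b d + dot a d * dot b c)).
Proof.
have h i j k l : has_mean P (fun t => X i t * X j t * X k t * X l t)
    (s ^+ 4 * ((i == j)%:R * (k == l)%:R + (i == k)%:R * (j == l)%:R
      + (i == l)%:R * (j == k)%:R)).
  apply: has_mean_eq (has_mean_monomial [:: i; j; k; l]) _ (M4 i j k l) => t.
  by rewrite !big_cons big_nil mulr1 !mulrA.
have h1 i j k : has_mean P (fun t => X i t * X j t * X k t * L d t)
    (s ^+ 4 * ((i == j)%:R * d k + (i == k)%:R * d j + d i * (j == k)%:R)).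
  apply: has_mean_eq (has_mean_sum _ (fun l => has_meanZ (d l) (h i j k l))) _ _ => [t|].
    by rewrite [L d t]/L mulr_sumr; apply: eq_bigr => l _; ring.
  rewrite -(sumr_delta d i) -(sumr_delta d j) -(sumr_delta d k) !mulr_sumr.
  rewrite mulr_suml -!big_split/= mulr_sumr.
  by apply: eq_bigr => l _; ring.
have h2 i j : has_mean P (fun t => X i t * X j t * L c t * L d t)
    (s ^+ 4 * ((i == j)%:R * dot c d + c i * d j + d i * c j)).
  apply: has_mean_eq (has_mean_sum _ (fun k => has_meanZ (c k) (h1 i j k))) _ _ => [t|].
    by rewrite [L c t]/L mulr_sumr mulr_suml; apply: eq_bigr => k _; ring.
  rewrite -(sumr_delta c i) -(sumr_delta c j) /dot !mulr_sumr.
  rewrite mulr_suml -!big_split/= mulr_sumr.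
  by apply: eq_bigr => k _; ring.
have h3 i : has_mean P (fun t => X i t * L b t * L c t * L d t)
    (s ^+ 4 * (b i * dot c d + c i * dot b d + d i * dot b c)).
  apply: has_mean_eq (has_mean_sum _ (fun j => has_meanZ (b j) (h2 i j))) _ _ => [t|].
    by rewrite [L b t]/L mulr_sumr !mulr_suml; apply: eq_bigr => j _; ring.
  move: (dot c d) => u.
  rewrite -(sumr_delta b i) [dot b d]/dot [dot b c]/dot !mulr_sumr.
  rewrite mulr_suml -!big_split/= mulr_sumr.
  by apply: eq_bigr => j _; ring.
apply: has_mean_eq (has_mean_sum _ (fun i => has_meanZ (a i) (h3 i))) _ _ => [t|].
  by rewrite [L a t]/L !mulr_suml; apply: eq_bigr => j _; ring.
move: (dot c d) (dot b d) (dot b c) => u1 u2 u3.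
rewrite [dot a b]/dot [dot a c]/dot [dot a d]/dot !mulr_suml.
rewrite -!big_split/= mulr_sumr.
by apply: eq_bigr => j _; ring.
Qed.

(** * A linear form plus a diagonal quadratic form *)

Section diagonal_quadratic.
Context (K : finType) (v : I -> R) (w : K -> I -> R) (c : K -> R) (q : R).
Hypothesis w_orth : forall k l, dot (w k) (w l) = q * (k == l)%:R.

Lemma has_mean_diagonal_quadratic :
  has_mean P (fun t => L v t + \sum_k c k * L (w k) t ^+ 2)
    (s ^+ 2 * q * \sum_k c k).
Proof.
have h := has_meanD (has_mean_linear_form v)
  (has_mean_sum (index_enum K) (fun k => has_meanZ (c k)
    (has_mean_linear_form2 (w k) (w k)))).
apply: has_mean_eq h _ _ => [t //|].
rewrite add0r mulr_sumr; apply: eq_bigr => k _.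
by rewrite w_orth eqxx/=; ring.
Qed.

(** In the expanded square, L^2 has mean s^2 |v|^2 and L Q has mean 0 by parity. For Q^2, Isserlis'
    formula gives for each pair k, l the product of the means of the two squares, summing to m^2,
    which cancels, plus twice their squared covariance, which orthogonality leaves only for k =
    l. *)
Lemma has_mean_diagonal_quadratic_sqr :
  has_mean P (fun t => (L v t + \sum_k c k * L (w k) t ^+ 2
                        - s ^+ 2 * q * \sum_k c k) ^+ 2)
    (s ^+ 2 * dot v v + 2 * s ^+ 4 * q ^+ 2 * \sum_k c k ^+ 2).
Proof.
pose Q t := \sum_k c k * L (w k) t ^+ 2.
set m := s ^+ 2 * q * \sum_k c k.
have hQ : has_mean P Q m.
  have h := has_meanB has_mean_diagonal_quadratic (has_mean_linear_form v).
  by apply: has_mean_eq h _ _ => [t|]; rewrite ?subr0// addrC addKr.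
have hLQ : has_mean P (fun t => L v t * Q t) 0.
  have h := has_mean_sum (index_enum K) (fun k => has_meanZ (c k)
    (has_mean_linear_form3 v (w k) (w k))).
  apply: has_mean_eq h _ _ => [t|].
    by rewrite mulr_sumr; apply: eq_bigr => k _; ring.
  by rewrite big1// => k _; rewrite mulr0.
have hQQ : has_mean P (fun t => Q t * Q t)
    (m ^+ 2 + 2 * s ^+ 4 * q ^+ 2 * \sum_k c k ^+ 2).
  have h := has_mean_sum (index_enum K) (fun k => has_meanZ (c k)
    (has_mean_sum (index_enum K) (fun l => has_meanZ (c l)
      (has_mean_linear_form4 (w k) (w k) (w l) (w l))))).
  apply: has_mean_eq h _ _ => [t|].
    rewrite mulr_suml; apply: eq_bigr => k _; rewrite [LHS]mulr_sumr [RHS]mulr_sumr.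
    by apply: eq_bigr => l _; ring.
  rewrite /m exprMn [(\sum_k c k) ^+ 2]expr2 mulr_suml !mulr_sumr -big_split/=.
  apply: eq_bigr => k _.
  rewrite -[c k ^+ 2]/(c k * c k) -[X in _ * (_ * X)](sumr_delta c k).
  rewrite !mulr_sumr -big_split/=; apply: eq_bigr => l _.
  by rewrite !w_orth !eqxx; case: eqP => _ /=; ring.
(* The square (L + Q - m)^2 is assembled as L^2 + 2 L Q + Q^2 - 2 m (L + Q) + m^2. *)
have h := has_meanD (has_meanD (has_meanD (has_mean_linear_form2 v v)
  (has_meanZ 2 hLQ)) hQQ)
  (has_meanD (has_meanZ (- 2 * m) (has_meanD (has_mean_linear_form v) hQ))
             (has_mean_cst P (m ^+ 2))).
apply: has_mean_eq h _ _ => [t|]; last by ring.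
by rewrite -/(Q t) /=; ring.
Qed.

End diagonal_quadratic.
End gaussian_forms.

(** * Least squares with orthogonal regressors *)

Section orthogonal_least_squares.
Context (R : realType) (n p : nat) (z : 'I_n -> 'I_p -> R) (N : R).
Hypothesis N_gt0 : 0 < N.
Hypothesis z_orth : forall j l, \sum_i z i j * z i l = N * (j == l)%:R.

(** With orthogonal columns of squared norm [N] the normal equations are diagonal, and this is their
    solution. *)
Definition ols (y : 'I_n -> R) (j : 'I_p) : R := (\sum_i y i * z i j) / N.

Lemma sum_sqr_orth (a : 'I_p -> R) :
  \sum_i (\sum_j a j * z i j) ^+ 2 = N * \sum_j a j ^+ 2.
Proof.
transitivity (\sum_i \sum_j \sum_l a j * a l * (z i j * z i l)).
  apply: eq_bigr => i _; rewrite expr2 mulr_suml; apply: eq_bigr => j _.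
  by rewrite mulr_sumr; apply: eq_bigr => l _; ring.
rewrite exchange_big mulr_sumr; apply: eq_bigr => j _ /=.
have -> : N * a j ^+ 2 = N * a j * \sum_l a l * (j == l)%:R.
  by rewrite sumr_delta expr2 mulrA.
rewrite exchange_big mulr_sumr/=.
by apply: eq_bigr => l _; rewrite -mulr_sumr z_orth; ring.
Qed.

Lemma residuals_expand (y : 'I_n -> R) (a : 'I_p -> R) :
  \sum_i (y i - \sum_j a j * z i j) ^+ 2 =
  \sum_i y i ^+ 2 + N * \sum_j (a j ^+ 2 - 2 * (a j * ols y j)).
Proof.
have cross : \sum_i y i * (\sum_j a j * z i j) = N * \sum_j a j * ols y j.
  under eq_bigr do rewrite mulr_sumr.
  rewrite exchange_big mulr_sumr; apply: eq_bigr => j _ /=.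
  have -> : N * (a j * ols y j) = a j * (\sum_i y i * z i j).
    by rewrite mulrCA [N * _]mulrC divfK ?gt_eqF.
  by rewrite mulr_sumr; apply: eq_bigr => i _; ring.
transitivity (\sum_i y i ^+ 2 + (\sum_i (\sum_j a j * z i j) ^+ 2
    - 2 * \sum_i y i * (\sum_j a j * z i j))).
  rewrite mulr_sumr -sumrB -big_split/=.
  by apply: eq_bigr => i _; ring.
by rewrite sum_sqr_orth cross sumrB mulrBr -mulr_sumr mulrCA.
Qed.

(** Completing the square in the expanded residual sum; since [N] is positive, this exhibits [ols y]
    as the only minimizer. *)
Lemma residuals_ols (y : 'I_n -> R) (a : 'I_p -> R) :
  \sum_i (y i - \sum_j a j * z i j) ^+ 2 =
  \sum_i (y i - \sum_j ols y j * z i j) ^+ 2 + N * \sum_j (a j - ols y j) ^+ 2.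
Proof.
rewrite !residuals_expand -addrA -mulrDr -big_split/=; congr (_ + _ * _).
by apply: eq_bigr => j _; ring.
Qed.

Lemma ols_linear (a : 'I_p -> R) (e : 'I_n -> R) (j : 'I_p) :
  ols (fun i => \sum_l a l * z i l + e i) j = a j + \sum_i z i j / N * e i.
Proof.
have N0 : N != 0 by rewrite gt_eqF.
rewrite /ols mulr_suml.
transitivity (\sum_i ((\sum_l a l * (z i j * z i l)) / N + z i j / N * e i)).
  apply: eq_bigr => i _; rewrite mulrDl mulrDl; congr (_ + _); last by ring.
  by rewrite mulr_suml; congr (_ / _); apply: eq_bigr => l _; ring.
rewrite big_split/= -mulr_suml exchange_big/=; congr (_ + _).
rewrite -[RHS](sumr_delta a j) mulr_suml; apply: eq_bigr => l _.
by rewrite -mulr_sumr z_orth; field.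
Qed.

End orthogonal_least_squares.

(** * The quadratic model as a linear model on the vertices *)

Section quadratic_model_least_squares.
Context (R : realType) (d n : nat) (alpha beta : 'I_d -> R).
Context (xs : 'I_n -> 'rV[R]_d).
Hypothesis n_ge1 : (1 <= n)%N.
Hypothesis alpha_neq0 : forall k, alpha k != 0.
Hypothesis xs_pm1 : forall i k, xs i 0 k = -1 \/ xs i 0 k = 1.
Hypothesis xs_sum : \sum_(i < n) xs i = 0.
Hypothesis xs_orth : forall k l : 'I_d,
  \sum_(i < n) xs i 0 k * xs i 0 l = n%:R * (k == l)%:R.
Local Notation f := (quadratic_model alpha beta).

Definition regressor (i : 'I_n) (j : 'I_d.+1) : R :=
  if unlift ord0 j is Some k then xs i 0 k else 1.

(** At a vertex every squared coordinate is 1, so the quadratic terms join the intercept in the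
    coefficient of index 0. *)
Definition linear_coef (theta : 'rV[R]_d.+1) (j : 'I_d.+1) : R :=
  if unlift ord0 j is Some k then alpha k * theta 0 (lift ord0 k)
  else theta 0 ord0 + \sum_k beta k * (theta 0 (lift ord0 k) ^+ 2 / 2).

Definition param_of_coef (a : 'I_d.+1 -> R) : 'rV[R]_d.+1 :=
  \row_j if unlift ord0 j is Some k then a j / alpha k
         else a ord0 - \sum_k beta k * ((a (lift ord0 k) / alpha k) ^+ 2 / 2).

Lemma regressor_orth j l :
  \sum_i regressor i j * regressor i l = n%:R * (j == l)%:R.
Proof.
have sum0 k : \sum_i xs i 0 k = 0.
  by have /rowP/(_ k) := xs_sum; rewrite summxE mxE.
rewrite /regressor; case: (unliftP ord0 j) => [k ->|->];
  case: (unliftP ord0 l) => [m ->|->].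
- by rewrite xs_orth (inj_eq lift_inj).
- under eq_bigr do rewrite mulr1.
  by rewrite sum0 eq_sym (negPf (neq_lift _ _)) mulr0.
- under eq_bigr do rewrite mul1r.
  by rewrite sum0 (negPf (neq_lift _ _)) mulr0.
- by under eq_bigr do rewrite mulr1; rewrite sumr_const card_ord eqxx mulr1.
Qed.

(** Adding and subtracting beta_k theta_k^2 / 2 moves these terms into the intercept and replaces
    the squared coordinate by itself minus 1, a factor that vanishes at the vertices. *)
Lemma quadratic_model_linear_coef (theta : 'rV[R]_d.+1) (x : 'rV[R]_d) :
  f x theta = linear_coef theta ord0
    + \sum_k linear_coef theta (lift ord0 k) * x 0 k
    + \sum_k beta k / (2 * alpha k ^+ 2) * (x 0 k ^+ 2 - 1)
        * linear_coef theta (lift ord0 k) ^+ 2.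
Proof.
rewrite /quadratic_model /linear_coef unlift_none -!addrA; congr (_ + _).
rewrite [RHS]addrCA; congr (_ + _).
  by apply: eq_bigr => k _; rewrite liftK.
rewrite -big_split/=; apply: eq_bigr => k _; rewrite liftK.
by field; rewrite alpha_neq0.
Qed.

Lemma quadratic_model_design (theta : 'rV[R]_d.+1) (i : 'I_n) :
  f (xs i) theta = \sum_j linear_coef theta j * regressor i j.
Proof.
rewrite quadratic_model_linear_coef big_ord_recl /regressor unlift_none mulr1.
rewrite [X in _ + X]big1 ?addr0; last first.
  move=> k _; case: (xs_pm1 i k) => ->; by ring.
by congr (_ + _); apply: eq_bigr => k _; rewrite liftK.
Qed.

Lemma param_of_coefK (a : 'I_d.+1 -> R) : linear_coef (param_of_coef a) =1 a.
Proof.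
move=> j; rewrite /linear_coef; case: (unliftP ord0 j) => [k ->|->].
  by rewrite mxE liftK mulrCA divff ?mulr1.
rewrite mxE unlift_none.
under [X in _ + X]eq_bigr do rewrite mxE liftK.
by rewrite subrK.
Qed.

Lemma linear_coef_inj (theta theta' : 'rV[R]_d.+1) :
  linear_coef theta =1 linear_coef theta' -> theta = theta'.
Proof.
move=> tt'.
have eqk k : theta 0 (lift ord0 k) = theta' 0 (lift ord0 k).
  by have := tt' (lift ord0 k); rewrite /linear_coef liftK => /(mulfI (alpha_neq0 k)).
apply/rowP => j; case: (unliftP ord0 j) => [k ->//|->].
have := tt' ord0; rewrite /linear_coef unlift_none.
under eq_bigr do rewrite eqk.
by move/addIr.
Qed.

(** The sum of squares is a constant plus n times the squared distance from [linear_coef theta] to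
    the least-squares coefficients, and [param_of_coef] attains distance 0. *)
Lemma least_squaresE (y : 'rV[R]_n) (theta : 'rV[R]_d.+1) :
  least_squares f xs y theta <->
  linear_coef theta =1 ols regressor n%:R (y 0).
Proof.
have n0 : 0 < n%:R :> R by rewrite ltr0n.
set a := ols _ _ _.
have ssE t : sum_squares f xs y t = \sum_i (y 0 i - \sum_j a j * regressor i j) ^+ 2
    + n%:R * \sum_j (linear_coef t j - a j) ^+ 2.
  rewrite -(residuals_ols n0 regressor_orth).
  by apply: eq_bigr => i _; rewrite quadratic_model_design.
split=> [tmin j|ta t']; last first.
  rewrite !ssE lerD2l ler_pM2l// big1 => [|j _]; last by rewrite ta subrr expr0n.
  by apply: sumr_ge0 => j _; exact: sqr_ge0.
have := tmin (param_of_coef a).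
rewrite !ssE lerD2l ler_pM2l// [X in _ <= X]big1 => [|l _]; last first.
  by rewrite param_of_coefK subrr expr0n.
move=> sum_le0; have /eqP : \sum_j (linear_coef theta j - a j) ^+ 2 = 0.
  apply/eqP; rewrite eq_le sum_le0/=.
  by apply: sumr_ge0 => l _; exact: sqr_ge0.
rewrite psumr_eq0 => [/allP/(_ j)|l _]; last exact: sqr_ge0.
by rewrite mem_index_enum sqrf_eq0 subr_eq0 => /(_ isT)/eqP.
Qed.

Lemma least_squares_unique (y : 'rV[R]_n) :
  exists! theta, least_squares f xs y theta.
Proof.
exists (param_of_coef (ols regressor n%:R (y 0))); split.
  by apply/least_squaresE; exact: param_of_coefK.
move=> t /least_squaresE ta; apply: linear_coef_inj => j.
by rewrite ta param_of_coefK.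
Qed.

(** A minimizer exists, so [xget] returns one rather than falling back on its default 0. *)
Lemma linear_coef_lse (y : 'rV[R]_n) :
  linear_coef (lse f xs y) =1 ols regressor n%:R (y 0).
Proof.
apply/least_squaresE; have [t [tmin _]] := least_squares_unique y.
exact: xgetPex (ex_intro _ t tmin).
Qed.

(** The error vector [e] is arbitrary, so this serves both for the random errors and, with [e] zero,
    for the mean observations. *)
Lemma linear_coef_lse_perturbed (y : 'rV[R]_n) (theta : 'rV[R]_d.+1)
    (e : 'I_n -> R) (j : 'I_d.+1) : (forall i, y 0 i = f (xs i) theta + e i) ->
  linear_coef (lse f xs y) j =
  linear_coef theta j + \sum_i regressor i j / n%:R * e i.
Proof.
move=> yE; have n0 : 0 < n%:R :> R by rewrite ltr0n.
rewrite linear_coef_lse -(ols_linear n0 regressor_orth).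
congr (ols _ _ _ _); apply/funext => i.
by rewrite yE quadratic_model_design.
Qed.

End quadratic_model_least_squares.

(** * Mean, variance and bias of the predictions *)

Theorem corollary2 (R : realType) (disp : measure_display)
    (T : measurableType disp) (P : probability T R)
    (d n : nat) (d_ge1 : (1 <= d)%N) (n_ge1 : (1 <= n)%N)
    (alpha beta : 'I_d -> R) (alpha_neq0 : forall k, alpha k != 0)
    (xs : 'I_n -> 'rV[R]_d)
    (xs_pm1 : forall i k, xs i 0 k = -1 \/ xs i 0 k = 1)
    (xs_sum : \sum_(i < n) xs i = 0)
    (xs_orth : forall k l : 'I_d,
       \sum_(i < n) xs i 0 k * xs i 0 l = n%:R * (k == l)%:R)
    (theta : 'rV[R]_d.+1) (sigma : R) (sigma_gt0 : 0 < sigma)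
    (eps : 'I_n -> {RV P >-> R})
    (eps_indep : mutually_independent P (fun i => eps i : T -> R))
    (eps_normal : forall (i : 'I_n) (B : set R), measurable B ->
       distribution P (eps i) B = normal_prob 0 sigma B) :
  let f := quadratic_model alpha beta in
  let y := observations f xs theta (fun i => eps i : T -> R) in
  [/\ forall y0 : 'rV[R]_n, exists! theta0, least_squares f xs y0 theta0,
      forall x : 'rV[R]_d, cube x ->
        expected_prediction P f xs y x =
          (f x theta
           + sigma ^+ 2 / (2 * n%:R)
             * \sum_(k < d) beta k / alpha k ^+ 2 * (x 0 k ^+ 2 - 1))%:E
        /\
        prediction_uncertainty P f xs y x =
          (sigma ^+ 2 / n%:R
             * (1 + \sum_(k < d)
                  (x 0 k + beta k / alpha k * (x 0 k ^+ 2 - 1)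
                           * theta 0 (lift ord0 k)) ^+ 2)
           + sigma ^+ 4 / (2 * n%:R ^+ 2)
             * \sum_(k < d) beta k ^+ 2 / alpha k ^+ 4
                            * (x 0 k ^+ 2 - 1) ^+ 2)%:E
    & (exists k, beta k != 0) ->
        exists2 x : 'rV[R]_d, cube x & biased_at P f xs y x].
Proof.
move=> f y.
have n0 : n%:R != 0 :> R by rewrite pnatr_eq0 -lt0n.
have s0 : sigma != 0 by rewrite gt_eqF.
have reg_orth := regressor_orth xs_sum xs_orth.
have mean_var (x : 'rV[R]_d) :
    expected_prediction P f xs y x =
      (f x theta + sigma ^+ 2 / (2 * n%:R)
         * \sum_(k < d) beta k / alpha k ^+ 2 * (x 0 k ^+ 2 - 1))%:E /\
    prediction_uncertainty P f xs y x =
      (sigma ^+ 2 / n%:R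
         * (1 + \sum_(k < d)
              (x 0 k + beta k / alpha k * (x 0 k ^+ 2 - 1)
                       * theta 0 (lift ord0 k)) ^+ 2)
       + sigma ^+ 4 / (2 * n%:R ^+ 2)
         * \sum_(k < d) beta k ^+ 2 / alpha k ^+ 4
                        * (x 0 k ^+ 2 - 1) ^+ 2)%:E.
  (* [z] carries the factor 1/n of the estimator, so its columns are orthogonal with squared norm
     1/n, the [q] of the quadratic form. *)
  pose z (i : 'I_n) j := regressor xs i j / n%:R.
  have z_orth j l : \sum_i z i j * z i l = n%:R^-1 * (j == l)%:R.
    transitivity (n%:R ^- 2 * \sum_i regressor xs i j * regressor xs i l).
      by rewrite mulr_sumr; apply: eq_bigr => i _; rewrite /z; field.
    by rewrite reg_orth; field.
  (* In the linear coefficients at the true parameter, [c k] is half a second derivative of the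
     prediction and [u j] a first derivative: for input k it is x^(k) + 2 c_k alpha_k theta_k. *)
  pose c k := beta k / (2 * alpha k ^+ 2) * (x 0 k ^+ 2 - 1).
  pose u j := if unlift ord0 j is Some k then
    x 0 k + beta k / alpha k * (x 0 k ^+ 2 - 1) * theta 0 (lift ord0 k) else 1.
  pose v i := \sum_j u j * z i j.
  pose w k i := z i (lift ord0 k).
  have w_orth k l : dot (w k) (w l) = n%:R^-1 * (k == l)%:R.
    by rewrite /dot z_orth (inj_eq lift_inj).
  have dot_v : dot v v = n%:R^-1 * (1 + \sum_(k < d) (x 0 k
      + beta k / alpha k * (x 0 k ^+ 2 - 1) * theta 0 (lift ord0 k)) ^+ 2).
    transitivity (n%:R^-1 * \sum_j u j ^+ 2).
      rewrite -(sum_sqr_orth z_orth).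
      by apply: eq_bigr => i _; rewrite expr2.
    rewrite big_ord_recl /u unlift_none expr1n.
    by congr (_ * (_ + _)); apply: eq_bigr => k _; rewrite liftK.
  (* The model is quadratic in the coefficients, so its second-order expansion around the true ones
     is exact. *)
  have predE t : f x (lse f xs (y t)) = f x theta
      + (linear_form eps v t + \sum_k c k * linear_form eps (w k) t ^+ 2).
    have coefE := linear_coef_lse_perturbed n_ge1 alpha_neq0 xs_pm1 xs_sum
      xs_orth (y := y t) (theta := theta) (e := fun i => eps i t).
    have vE : linear_form eps v t = \sum_i z i ord0 * eps i t
        + \sum_k u (lift ord0 k) * linear_form eps (w k) t.
      transitivity (\sum_j u j * \sum_i z i j * eps i t).
        under [RHS]eq_bigr do rewrite mulr_sumr.
        rewrite exchange_big; apply: eq_bigr => i _ /=.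
        by rewrite mulr_suml; apply: eq_bigr => j _; rewrite mulrA.
      by rewrite big_ord_recl /u unlift_none mul1r.
    rewrite /f !(quadratic_model_linear_coef _ alpha_neq0).
    rewrite coefE => [|i]; last by rewrite mxE.
    under [X in _ + X + _]eq_bigr => k _.
      rewrite coefE => [|i]; last by rewrite mxE.
      over.
    under [X in _ + X = _]eq_bigr => k _.
      rewrite coefE => [|i]; last by rewrite mxE.
      over.
    rewrite vE.
    pose e k := linear_form eps (w k) t.
    pose a k := linear_coef alpha beta theta (lift ord0 k).
    transitivity (linear_coef alpha beta theta ord0 + \sum_i z i ord0 * eps i t
      + \sum_k ((a k + e k) * x 0 k + c k * (a k + e k) ^+ 2)).
      by rewrite [X in _ = _ + X]big_split/= !addrA.
    transitivity (linear_coef alpha beta theta ord0 + \sum_i z i ord0 * eps i t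
      + \sum_k (a k * x 0 k + c k * a k ^+ 2
                + (u (lift ord0 k) * e k + c k * e k ^+ 2))).
      congr (_ + _); apply: eq_bigr => k _.
      rewrite /u liftK /c /a /linear_coef liftK.
      by field; rewrite alpha_neq0.
    by rewrite !big_split/=; ring.
  have h := has_meanD (has_mean_cst P (f x theta))
    (has_mean_diagonal_quadratic s0 eps_indep eps_normal v c w_orth).
  have hE : expected_prediction P f xs y x =
      (f x theta + sigma ^+ 2 * n%:R^-1 * \sum_k c k)%:E.
    rewrite /expected_prediction; have [_ <-] := h.
    by congr ('E_P[_])%E; apply/funext => t; rewrite predE.
  split.
    rewrite hE; congr (_ + _)%:E; rewrite !mulr_sumr; apply: eq_bigr => k _.
    by rewrite /c; field; rewrite n0 alpha_neq0.
  rewrite /prediction_uncertainty /variance covariance.unlock -/(expected_prediction P f xs y x) hE.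
  have [_ hV] := has_mean_diagonal_quadratic_sqr s0 eps_indep eps_normal v c w_orth.
  transitivity ((sigma ^+ 2 * dot v v + 2 * sigma ^+ 4 * n%:R^-1 ^+ 2 * \sum_k c k ^+ 2)%:E).
    rewrite -hV; congr ('E_P[_])%E; apply/funext => t.
    rewrite /= -expr2; congr (_ ^+ 2).
    rewrite -[LHS]/(f x (lse f xs (y t))
      - (f x theta + sigma ^+ 2 / n%:R * \sum_k c k)) predE.
    by ring.
  rewrite dot_v mulrA; congr (_ + _)%:E; rewrite !mulr_sumr; apply: eq_bigr => k _.
  by rewrite /c; field; rewrite n0 alpha_neq0.
split=> [y0|x _|[k0 beta0]].
- exact: least_squares_unique.
- exact: mean_var.
(* The bias vanishes at the vertices, and everywhere if all beta_k are 0. With coordinate [k0] equal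
   to 0 and the others equal to 1, only the term of [k0] remains, with factor -1. *)
pose x : 'rV[R]_d := \row_k (k != k0)%:R.
exists x => [k|]; first by rewrite mxE; case: (k != k0) => /=; lra.
rewrite /biased_at (mean_var x).1.
(* The noise is centred, so the mean observations are exact values of the model at [theta], and the
   estimator returns [theta]. *)
have -> : lse f xs (mean_vector P y) = theta.
  apply: (linear_coef_inj alpha_neq0 (beta := beta)) => j.
  rewrite (linear_coef_lse_perturbed n_ge1 alpha_neq0 xs_pm1 xs_sum xs_orth
    (theta := theta) (e := fun=> 0)).
    by rewrite big1 ?addr0// => i _; rewrite mulr0.
  move=> i; rewrite mxE addr0.
  have h := has_meanD (has_mean_cst P (f (xs i) theta))
    (has_mean_normal_expr s0 (eps_normal i) 1).
  rewrite -[RHS]addr0; transitivity (fine (f (xs i) theta + 0)%:E) => //.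
  by congr fine; rewrite -h.2; congr ('E_P[_])%E; apply/funext => t; rewrite mxE.
move=> [] /eqP; rewrite -subr_eq0 addrC addKr; apply/negP.
rewrite (bigD1 k0)//= big1 => [|k kk0]; last first.
  by rewrite mxE kk0 expr1n subrr mulr0.
rewrite addr0 mxE eqxx expr0n/= sub0r mulrN1 mulrN oppr_eq0.
by rewrite !mulf_neq0 ?invr_eq0 ?expf_neq0 ?mulf_neq0.
Qed.
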